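(* Let $M=\{\bigcap_{x\in E}\mathord{\downarrow}x\mid \emptyset\neq E\subseteq P\}$, ordered by inclusion, where $P$ is the poset described in the context, and let $R=M\cup\{T\}$ be obtained from $M$ by adding a new greatest element $T$. Then $R$ is a countable complete lattice whose Scott space $\Sigma R$ is not sober.
   Context: $\mathbb{N}$ is the set of positive integers and $\mathbb{N}^{<\mathbb{N}}$ is the set of non-empty finite sequences of elements of $\mathbb{N}$; $s.t$ denotes concatenation, and $|s|$ the length of $s$. For $s,t\in\mathbb{N}^{<\mathbb{N}}$, $s\le t$ means that $s$ is a prefix of $t$ (possibly $s=t$). A natural number $x$ is also regarded as the sequence of length one when it is an argument of a function on $\mathbb{N}^{<\mathbb{N}}$ or appears in a concatenation. Let $L$ be the disjoint union $\mathbb{N}\cup\mathbb{N}^{<\mathbb{N}}\cup\{\top\}$ ordered by: $x\le y$ iff $x,y\in\mathbb{N}$ and $x\le y$ in the usual order; or $x,y\in\mathbb{N}^{<\mathbb{N}}$ and $x$ is a prefix of $y$; or $y=\top$. For every pair $(m,n)\in\mathbb{N}\times\mathbb{N}$ with $m<n$ fix an infinite set $i(m,n)\subseteq\mathbb{N}$ such that every element of $i(m,n)$ is strictly greater than $n$, and such that $i(m_1,n_1)\cap i(m_2,n_2)=\emptyset$ for distinct pairs $(m_1,n_1)\ne(m_2,n_2)$ with $m_1<n_1$, $m_2<n_2$. For each $(m,n)$ with $m<n$ fix a monotone bijection $f_{m,n}:\mathbb{N}^{<\mathbb{N}}\to i(m,n)$ (monotone from the prefix order to the usual order). Let $P=\mathbb{N}\times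 L$ as a set, with the relations: - $(n,x)<_1(m,y)$ iff $n=m$ and $x<y$ in $L$; - $(n,x)<_2(m,y)$ iff $y=\top$, $x\in\mathbb{N}^{<\mathbb{N}}$, and there is $k\in\mathbb{N}$ with $k>n$, $m\in i(n,k)$ and $m=f_{n,k}(x)$; - $(n,x)<_3(m,y)$ iff $y=\top$, $x\in\mathbb{N}$, and there is $d\in\mathbb{N}$ with $d<n$, $m\in i(d,n)$ and $m=f_{d,n}(x)$; - $(n,x)<_4(m,y)$ iff $y=\top$, $x\in\mathbb{N}$, and there are $a,b\in\mathbb{N}$ with $a<b$ and $s\in\mathbb{N}^{<\mathbb{N}}$ such that $f_{a,b}(s)=n$ and $f_{a,b}(s.x)=m$. Let $<$ be the union of $<_1,<_2,<_3,<_4$ and the relation compositions $<_1;<_2$, $<_1;<_3$, $<_1;<_4$ (where $u\,(<_1;<_j)\,v$ iff there is $w$ with $u<_1w<_jv$). The order on $P$ is $u\le v$ iff $u<v$ or $u=v$. For $x\in P$, $\mathord{\downarrow}x=\{y\in P\mid y\le x\}$. For a poset $Q$, $\Sigma Q$ is $Q$ with the Scott topology: $U\subseteq Q$ is open iff it is an upper set and every directed $D\subseteq Q$ whose supremum exists and lies in $U$ meets $U$. A space is sober if it is $T_0$ and every irreducible closed subset is the closure of a (unique) point. *)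

(* Defs.v *)
From HB Require Import structures.
From mathcomp Require Import all_boot all_order.
From mathcomp Require Import all_classical topology.

Set Implicit Arguments.
Unset Strict Implicit.
Unset Printing Implicit Defensive.

Import Order.TTheory.

Local Open Scope order_scope.
Local Open Scope classical_set_scope.

Section CompleteLattice.
Context {d : Order.disp_t}.

Definition complete_lattice (T : porderType d) : Prop :=
  forall A : set T, supremums A !=set0 /\ infimums A !=set0.

End CompleteLattice.

Section WithTop.
Context {d : Order.disp_t}.

(* [None] is the added greatest element. *)
Definition with_top (T : Type) : Type := option T.

HB.instance Definition _ (T : choiceType) := Choice.copy (with_top T) (option T).

Variable T : porderType d.

Definition with_top_le (x y : with_top T) : bool :=
  match x, y with
  | _, None => true
  | Some a, Some b => a <= b
  | None, Some _ => false
  end.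

Lemma with_top_le_refl : reflexive with_top_le.
Proof. by case=> /=. Qed.

Lemma with_top_le_anti : antisymmetric with_top_le.
Proof. by case=> [a|] [b|] //= /le_anti ->. Qed.

Lemma with_top_le_trans : transitive with_top_le.
Proof. by case=> [b|] [a|] [c|] //=; exact: le_trans. Qed.

HB.instance Definition _ := Order.Le_isPOrder.Build d (with_top T)
  with_top_le_refl with_top_le_anti with_top_le_trans.

End WithTop.

Section Scott.
Context {d : Order.disp_t}.

Definition directed_set (Q : porderType d) (D : set Q) : Prop :=
  D !=set0 /\
  forall x y, D x -> D y -> exists z, [/\ D z, x <= z & y <= z].

Definition upper_set (Q : porderType d) (U : set Q) : Prop :=
  forall x y, U x -> x <= y -> U y.

Definition scott_open (Q : porderType d) (U : set Q) : Prop :=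
  upper_set U /\
  forall (D : set Q) (s : Q),
    directed_set D -> supremums D s -> U s -> U `&` D !=set0.

Lemma scott_openT (Q : porderType d) : scott_open [set: Q].
Proof. by split=> // D s [[x Dx] _] _ _; exists x. Qed.

Lemma scott_openI (Q : porderType d) : setI_closed (@scott_open Q).
Proof.
move=> U V [uU oU] [uV oV]; split.
  by move=> x y [Ux Vx] xy; split; [exact: uU xy | exact: uV xy].
move=> D s dD sD [Us Vs].
have [x [Ux Dx]] := oU D s dD sD Us; have [y [Vy Dy]] := oV D s dD sD Vs.
have [z [Dz xz yz]] := dD.2 x y Dx Dy.
by exists z; split=> //; split; [exact: uU xz | exact: uV yz].
Qed.

Lemma scott_open_bigU (Q : porderType d) (I : Type) (F : I -> set Q) :
  (forall i, scott_open (F i)) -> scott_open (\bigcup_i F i).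
Proof.
move=> oF; split=> [x y [i _ Fx] xy|D s dD sD [i _ Fs]].
  by exists i => //; exact: (oF i).1 Fx xy.
have [x [Fx Dx]] := (oF i).2 D s dD sD Fs.
by exists x; split=> //; exists i.
Qed.

(* The poset [Q] equipped with its Scott topology. *)
Definition scott (Q : porderType d) : Type := Q.

HB.instance Definition _ (Q : porderType d) := Choice.on (scott Q).

HB.instance Definition _ (Q : porderType d) :=
  isOpenTopological.Build (scott Q)
    (@scott_openT Q) (@scott_openI Q) (@scott_open_bigU Q).

Lemma scott_openE (Q : porderType d) (U : set (scott Q)) :
  open U <-> scott_open (U : set Q).
Proof.
rewrite openE; split=> [oU|oU x Ux]; last by exists U; split.
suff -> : U = \bigcup_(B : {B : set Q | scott_open B /\ B `<=` U}) sval B.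
  by apply: scott_open_bigU => -[B []].
apply/seteqP; split=> [x /oU[B [oB Bx BU]]|x [[B [oB BU]] _ /= /BU//]].
by exists (exist _ B (conj oB BU)).
Qed.

End Scott.

Section Sober.

Definition irreducible_set (T : topologicalType) (A : set T) : Prop :=
  A !=set0 /\
  forall B C : set T, closed B -> closed C ->
    A `<=` B `|` C -> A `<=` B \/ A `<=` C.

Definition sober_space (T : topologicalType) : Prop :=
  kolmogorov_space T /\
  forall A : set T, closed A -> irreducible_set A ->
    exists x : T, A = closure [set x].

End Sober.

Definition posnat : Type := {n : nat | (0 < n)%N}.

HB.instance Definition _ := SubCountable.on posnat.
HB.instance Definition _ :=
  [SubChoice_isSubOrder of posnat by <: with Order.default_display].

Definition neseq : Type := {s : seq posnat | s != [::]}.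

HB.instance Definition _ := SubCountable.on neseq.

Definition neseq_le (s t : neseq) : bool := prefix (val s) (val t).

Definition neseq1 (x : posnat) : neseq := exist _ [:: x] isT.

Lemma neseq_cat_subproof (s t : neseq) : val s ++ val t != [::].
Proof. by case: s => -[]. Qed.

Definition neseq_cat (s t : neseq) : neseq :=
  exist _ (val s ++ val t) (neseq_cat_subproof s t).

Inductive L : Type := LNat of posnat | LSeq of neseq | LTop.

Definition L_to_sum (x : L) : option (posnat + neseq) :=
  match x with
  | LNat n => Some (inl n) | LSeq s => Some (inr s) | LTop => None
  end.

Definition L_of_sum (x : option (posnat + neseq)) : L :=
  match x with
  | Some (inl n) => LNat n | Some (inr s) => LSeq s | None => LTop
  end.

Lemma L_to_sumK : cancel L_to_sum L_of_sum.
Proof. by case. Qed.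

HB.instance Definition _ := Countable.copy L (can_type L_to_sumK).

Definition L_le (x y : L) : bool :=
  match x, y with
  | _, LTop => true
  | LNat m, LNat n => m <= n
  | LSeq s, LSeq t => neseq_le s t
  | _, _ => false
  end.

Lemma L_le_refl : reflexive L_le.
Proof. by case=> //= s; exact: prefix_refl. Qed.

Lemma L_le_anti : antisymmetric L_le.
Proof.
case=> [m|s|] [n|t|] //=; first by move/le_anti ->.
rewrite /neseq_le !prefixE => /andP[/eqP st /eqP ts]; congr LSeq; apply/val_inj.
have /(congr1 size) := st; have /(congr1 size) := ts; rewrite !size_take_min.
by move=> _ st_size; rewrite -[RHS]ts take_oversize // -st_size geq_minr.
Qed.

Lemma L_le_trans : transitive L_le.
Proof.
case=> [m|s|] [n|t|] [p|u|] //=; first exact: le_trans.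
exact: prefix_trans.
Qed.

HB.instance Definition _ := Order.Le_isPOrder.Build Order.default_display L
  L_le_refl L_le_anti L_le_trans.

Section RelationsP.
Variables (i : posnat -> posnat -> set posnat).
Variables (f : posnat -> posnat -> neseq -> posnat).

Implicit Types u v w : posnat * L.

Definition P_lt1 u v : Prop := u.1 = v.1 /\ u.2 < v.2.

Definition P_lt2 u v : Prop :=
  v.2 = LTop /\ exists2 x : neseq, u.2 = LSeq x &
    exists k : posnat, [/\ u.1 < k, i u.1 k v.1 & v.1 = f u.1 k x].

Definition P_lt3 u v : Prop :=
  v.2 = LTop /\ exists2 x : posnat, u.2 = LNat x &
    exists d : posnat, [/\ d < u.1, i d u.1 v.1 & v.1 = f d u.1 (neseq1 x)].

Definition P_lt4 u v : Prop :=
  v.2 = LTop /\ exists2 x : posnat, u.2 = LNat x &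
    exists (a b : posnat) (s : neseq),
      [/\ a < b, f a b s = u.1 & f a b (neseq_cat s (neseq1 x)) = v.1].

Definition rel_comp (r s : posnat * L -> posnat * L -> Prop) u v : Prop :=
  exists w, r u w /\ s w v.

Definition P_lt u v : Prop :=
  P_lt1 u v \/ P_lt2 u v \/ P_lt3 u v \/ P_lt4 u v \/
  rel_comp P_lt1 P_lt2 u v \/ rel_comp P_lt1 P_lt3 u v \/
  rel_comp P_lt1 P_lt4 u v.

Lemma P_lt1_notop u v : P_lt1 u v -> u.2 <> LTop.
Proof.
by case=> _ + u2; rewrite u2 lt_neqAle => /andP[]; case: (v.2).
Qed.

Lemma P_lt_notop u v : P_lt u v -> u.2 <> LTop.
Proof.
case=> [/P_lt1_notop //|[[_ [x ->]] //|[[_ [x ->]] //|[[_ [x ->]] //|]]]].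
by case=> [|[|]] [w [/P_lt1_notop]].
Qed.

Lemma P_lt_top u v : P_lt u v -> P_lt1 u v \/ v.2 = LTop.
Proof.
case=> [|[[]|[[]|[[]|]]]]; try by [left|right].
by case=> [|[|]] [w [_ []]]; right.
Qed.

Lemma P_lt1_trans v u w : P_lt1 u v -> P_lt1 v w -> P_lt1 u w.
Proof.
by case=> uv1 uv2 [vw1 vw2]; split; [rewrite uv1|exact: lt_trans uv2 vw2].
Qed.

Lemma P_lt_irr u : ~ P_lt u u.
Proof.
move=> uu; have [[_]|] := P_lt_top uu; first by rewrite ltxx.
exact: P_lt_notop uu.
Qed.

Lemma P_lt_trans v u w : P_lt u v -> P_lt v w -> P_lt u w.
Proof.
move=> /P_lt_top[uv|vT vw]; last by have := P_lt_notop vw.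
case=> [vw|[vw|[vw|[vw|]]]].
- by left; exact: P_lt1_trans uv vw.
- by do 4 right; left; exists v.
- by do 5 right; left; exists v.
- by do 6 right; exists v.
case=> [|[|]] [x [vx xw]]; have ux := P_lt1_trans uv vx.
- by do 4 right; left; exists x.
- by do 5 right; left; exists x.
- by do 6 right; exists x.
Qed.

End RelationsP.

(* The phantom parameters [i] and [f] determine the order put on [P i f]. *)
Definition P (i : posnat -> posnat -> set posnat)
  (f : posnat -> posnat -> neseq -> posnat) : Type := (posnat * L)%type.

Section PosetP.
Variables (i : posnat -> posnat -> set posnat).
Variables (f : posnat -> posnat -> neseq -> posnat).

HB.instance Definition _ := Countable.on (P i f).

Definition P_ltb (u v : P i f) : bool := `[< @P_lt i f u v >].

Lemma P_ltb_irr : irreflexive P_ltb.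
Proof. by move=> u; apply/asboolPn; exact: P_lt_irr. Qed.

Lemma P_ltb_trans : transitive P_ltb.
Proof.
by move=> v u w /asboolP uv /asboolP vw; apply/asboolP; exact: P_lt_trans uv vw.
Qed.

(* This factory defines [u <= v] as [(u == v) || P_ltb u v]. *)
HB.instance Definition _ := Order.Lt_isPOrder.Build Order.default_display (P i f)
  P_ltb_irr P_ltb_trans.

Definition down_set (x : P i f) : set (P i f) := [set y | y <= x].

Definition M : Type :=
  set_type [set A : set (P i f) |
    exists2 E : set (P i f), E !=set0 & A = \bigcap_(x in E) down_set x].

(* The order on [M] is the one of [set (P i f)], namely inclusion. *)
HB.instance Definition _ := SubChoice.on M.
HB.instance Definition _ := [SubChoice_isSubPOrder of M by <: with set_display].

Definition R : porderType set_display := with_top M.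

End PosetP.

(* Main.v *)
Require Import Defs.
From mathcomp Require Import all_boot all_order.
From mathcomp Require Import all_classical topology.

(** In [P], the set below a maximal element [(m, LTop)] is the whole level [m]
    together with finitely many elements, lying on at most two lower levels
    [a < c], which exist only if [m = f a b s] and are then determined by [m].
    Hence a member of [M] is finite or of the form [down_set v], so [R] is
    countable, and [R] is complete because [M] is closed under nonempty
    intersections.

    The witness against sobriety is [M], the set of all elements of [R] but the
    top one. It is Scott closed because a directed family in [M] is bounded
    in [M]: two elements on levels [p < q] have at most one common maximal upper
    bound unless the first lies below [(q, LTop)]. It is not the closure of a
    point because [P] has several maximal elements. It is irreducible: if
    open sets [U] and [V] contain the down-sets of [(m, LTop)] and [(n, LTop)],
    [m < n], then [V] contains that of [(n, LNat x0)] for some [x0], hence that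
    of [(f m n x0, LTop)], hence that of [(f m n (x0.x1), LTop)] for some [x1],
    and so on. As the chain [(m, LSeq (x0...xk))] has supremum [(m, LTop)], [U]
    contains the down-set of one of its members, and this member lies below
    [(f m n (x0...xk), LTop)], whose down-set is thus in both [U] and [V]. *)

Set Implicit Arguments.
Unset Strict Implicit.
Unset Printing Implicit Defensive.

Import Order.TTheory.

Local Open Scope order_scope.
Local Open Scope classical_set_scope.

(** * Prefixes of sequences and finite down-sets of [L] *)

Lemma posnat_le_finite (x : posnat) : finite_set [set y : posnat | y <= x].
Proof.
apply: (@sub_finite_set _ _ (val @^-1` `I_(val x).+1)).
  by move=> y /=; rewrite ltnS.
by apply: finite_preimage => [y z _ _ /val_inj|]; last exact: finite_II.
Qed.

Lemma neseq_le_finite (s : neseq) : finite_set [set t : neseq | neseq_le t s].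
Proof.
pose T := [seq take k (val s) | k <- iota 0 (size (val s)).+1].
apply: (@sub_finite_set _ _ (val @^-1` [set` T])).
  move=> t /= st; apply/mapP; exists (size (val t)); last first.
    by apply/esym/eqP; rewrite -prefixE.
  by rewrite mem_iota add0n ltnS /=; exact: size_prefix.
by apply: finite_preimage => [y z _ _ /val_inj|]; last exact: finite_seq.
Qed.

Lemma neseq_le_catP (s t : neseq) (x : posnat) :
  neseq_le t (neseq_cat s (neseq1 x)) ->
  neseq_le t s \/ t = neseq_cat s (neseq1 x).
Proof.
case: t s => [t t0] [s s0] /prefixP[/= u]; case/lastP: u => [|u y].
  by rewrite cats0 => e; right; exact/val_inj.
rewrite cats1 -rcons_cat => /rcons_inj[e _]; left; apply/prefixP.
by exists u.
Qed.

Lemma neseq_cat_inj (s t : neseq) (x y : posnat) :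
  neseq_cat s (neseq1 x) = neseq_cat t (neseq1 y) -> s = t.
Proof.
by move/(congr1 val); rewrite /= !cats1 => /rcons_inj[st _]; exact/val_inj.
Qed.

Lemma neseq1_neq_cat (s : neseq) (x y : posnat) :
  neseq1 x <> neseq_cat s (neseq1 y).
Proof. by case: s => -[//|a [|b s]] s0 /(congr1 val). Qed.

Lemma neseq_le1 (t : neseq) (x : posnat) : neseq_le t (neseq1 x) -> t = neseq1 x.
Proof.
case: t => t t0 tx; have : prefix t [:: x] by [].
rewrite prefixs1 (negPf t0) /= => /eqP e; exact/val_inj.
Qed.

Lemma le_LTop (x : L) : x <= LTop.
Proof. by case: x. Qed.

Lemma L_le_finite (x : L) : x <> LTop -> finite_set [set y : L | y <= x].
Proof.
case: x => [n|s|//] _.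
  apply: sub_finite_set (finite_image LNat (posnat_le_finite n)).
  by case=> //= m mn; exists m.
apply: sub_finite_set (finite_image LSeq (neseq_le_finite s)).
by case=> //= t ts; exists t.
Qed.

Section PosetP.
Variables (i : posnat -> posnat -> set posnat).
Variables (f : posnat -> posnat -> neseq -> posnat).
Hypothesis i_gt : forall m n : posnat, m < n -> forall k, i m n k -> n < k.
Hypothesis i_disj : forall m1 n1 m2 n2 : posnat, m1 < n1 -> m2 < n2 ->
  (m1, n1) <> (m2, n2) -> i m1 n1 `&` i m2 n2 = set0.
Hypothesis f_bij :
  forall m n : posnat, m < n -> set_bij [set: neseq] (i m n) (f m n).
Hypothesis f_mono : forall m n : posnat, m < n ->
  forall s t : neseq, neseq_le s t -> f m n s <= f m n t.

Implicit Types (u v w : P i f) (a b m n p q : posnat) (s t : neseq).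

Notation top m := ((m, LTop) : P i f).

(** * Injectivity and growth of the maps [f] *)

Lemma f_in a b s : a < b -> i a b (f a b s).
Proof. by case/f_bij => + _ _; apply. Qed.

Lemma f_gt a b s : a < b -> b < f a b s.
Proof. by move=> ab; apply: i_gt ab _ (f_in s ab). Qed.

Lemma f_inj a b a' b' s s' : a < b -> a' < b' -> f a b s = f a' b' s' ->
  [/\ a = a', b = b' & s = s'].
Proof.
move=> ab ab' e; have [[aa bb]|ne] := pselect ((a, b) = (a', b')).
  subst a' b'; split=> //; have [_ inj _] := f_bij ab.
  by apply: inj e; rewrite in_setT.
have : (i a b `&` i a' b') (f a b s) by split; [|rewrite e]; exact: f_in.
by rewrite i_disj.
Qed.

Lemma f_lt_cat a b s x : a < b -> f a b s < f a b (neseq_cat s (neseq1 x)).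
Proof.
move=> ab; rewrite lt_neqAle f_mono ?andbT //; last exact: prefix_prefix.
apply/eqP => /(f_inj ab ab)[_ _ /(congr1 (size \o val)) /=].
by rewrite size_cat addn1 => /n_Sn.
Qed.

(** * The order of [P] and the elements under a maximal one *)

Lemma P_leE u v : u <= v <-> u = v \/ P_lt i f u v.
Proof.
rewrite le_eqVlt; split=> [/orP[/eqP|/asboolP]|[->|/asboolP uv]]; last 1 first.
- by apply/orP; right.
- by left.
- by right.
by rewrite eqxx.
Qed.

Lemma P_le_notop u v : v.2 <> LTop -> u <= v -> u.1 = v.1 /\ u.2 <= v.2.
Proof.
move=> vT /P_leE[-> //|/P_lt_top[[-> /ltW]|] //].
Qed.

Lemma P_le_level n (x y : L) : x <= y -> (n, x) <= (n, y) :> P i f.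
Proof.
rewrite le_eqVlt => /orP[/eqP-> //|xy].
by apply/P_leE; right; left.
Qed.

(* The lower and upper levels [a] and [c] of the elements below [(m, LTop)],
   for [m = f a b s]: [c] is [b] when [s] has length one, and [f a b s0] when
   [s = s0.x]. *)
Definition last_split a b s c (x : posnat) : Prop :=
  (s = neseq1 x /\ c = b) \/
  exists2 s0, s = neseq_cat s0 (neseq1 x) & c = f a b s0.

(** The first alternative comes from [P_lt2], the second from [P_lt3] and [P_lt4], each closed
    downward within its level to absorb the compositions with [P_lt1]. *)
Definition below m u : Prop :=
  exists a b s, [/\ a < b, m = f a b s &
    (u.1 = a /\ exists2 t, u.2 = LSeq t & neseq_le t s) \/
    (exists2 y, u.2 = LNat y & exists2 x, y <= x & last_split a b s u.1 x)].

Lemma le_topP u m : u <= top m <-> u.1 = m \/ below m u.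
Proof.
split=> [/P_leE[->|]|[um|[a [b [s [ab -> ]]]]]].
- by left.
- have lt1L v w (s : neseq) : P_lt1 v w -> w.2 = LSeq s ->
      v.1 = w.1 /\ exists2 t, v.2 = LSeq t & neseq_le t s.
    case=> vw /ltW vw2 ws; split=> //; move: vw2; rewrite ws.
    by case: (v.2) => // t; exists t.
  have lt1N v w (x : posnat) : P_lt1 v w -> w.2 = LNat x ->
      v.1 = w.1 /\ exists2 y, v.2 = LNat y & y <= x.
    case=> vw /ltW vw2 ws; split=> //; move: vw2; rewrite ws.
    by case: (v.2) => // t; exists t.
  have lt2B v w s : P_lt2 i f w (m, LTop) -> w.2 = LSeq s -> v.1 = w.1 ->
      (exists2 t, v.2 = LSeq t & neseq_le t s) -> below m v.
    move=> [_ [s' -> [k [wk _ /= ->]]]] [->] vw vs.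
    by exists w.1, k, s; split=> //; left.
  have lt3B v w (x : posnat) : P_lt3 i f w (m, LTop) -> w.2 = LNat x ->
      v.1 = w.1 -> (exists2 y, v.2 = LNat y & y <= x) -> below m v.
    move=> [_ [x' -> [d [wk _ /= ->]]]] [->] vw [y vy yx].
    exists d, w.1, (neseq1 x); split=> //; right; exists y => //; exists x => //.
    by left.
  have lt4B v w (x : posnat) : P_lt4 f w (m, LTop) -> w.2 = LNat x ->
      v.1 = w.1 -> (exists2 y, v.2 = LNat y & y <= x) -> below m v.
    move=> [_ [x' -> [a [b [s [ab <- /= <-]]]]]] [->] vw [y vy yx].
    exists a, b, (neseq_cat s (neseq1 x)); split=> //.
    right; exists y => //; exists x => //.
    by right; exists s.
  case=> [[-> _]|[h|[h|[h|[|[|]]]]]]; first by left.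
  + right; case: (h) => _ [s us _]; apply: (lt2B u u s h us erefl).
    by exists s => //; exact: prefix_refl.
  + right; case: (h) => _ [s us _]; apply: (lt3B u u s h us erefl).
    by exists s.
  + right; case: (h) => _ [s us _]; apply: (lt4B u u s h us erefl).
    by exists s.
  + case=> w [uw h]; right; case: (h) => _ [s ws _].
    by have [uw1 us] := lt1L _ _ _ uw ws; apply: lt2B h ws uw1 us.
  + case=> w [uw h]; right; case: (h) => _ [s ws _].
    by have [uw1 us] := lt1N _ _ _ uw ws; apply: lt3B h ws uw1 us.
  + case=> w [uw h]; right; case: (h) => _ [s ws _].
    by have [uw1 us] := lt1N _ _ _ uw ws; apply: lt4B h ws uw1 us.
- by case: u um => n x /= ->; exact: P_le_level (le_LTop x).
case: u => n z /= [[-> [t -> ts]]|[y -> [x yx]]].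
  apply: (@le_trans _ _ ((a, LSeq s) : P i f)); first exact: P_le_level.
  apply/P_leE; right; right; left; split=> //; exists s => //.
  by exists b; split=> //; exact: f_in.
move=> h; apply: (@le_trans _ _ ((n, LNat x) : P i f)); first exact: P_le_level.
apply/P_leE; right; right; right; case: h => [[-> ->]|[s0 -> ->]].
  left; split=> //; exists x => //; exists a; split=> //; exact: f_in.
right; left; split=> //; exists x => //; exists a, b, s0; split=> //.
Qed.

Lemma last_split_lt a b s c x : a < b -> last_split a b s c x ->
  a < c /\ c < f a b s.
Proof.
move=> ab [[-> ->]|[s0 -> ->]]; first by split=> //; exact: f_gt.
split; last exact: f_lt_cat.
exact: lt_trans ab (f_gt _ ab).
Qed.

Lemma below_lt m u : below m u -> u.1 < m.
Proof.
case=> a [b [s [ab -> [[-> _]|[y _ [x _ /(last_split_lt ab)[_ ?//]]]]]]].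
exact: lt_trans ab (f_gt _ ab).
Qed.

Lemma last_split_fun a b s c c' x x' :
  last_split a b s c x -> last_split a b s c' x' -> c = c' /\ x = x'.
Proof.
move=> [[-> ->]|[s0 -> ->]] [[e ->]|[s1 e ->]].
- by case: e => ->.
- by case: (neseq1_neq_cat e).
- by case: (neseq1_neq_cat (esym e)).
move: (e) => /neseq_cat_inj ee; subst s1; split=> //.
by move: e => /(congr1 val); rewrite /= !cats1 => /rcons_inj[].
Qed.

Lemma below_levels m : exists a c, forall u, below m u -> u.1 = a \/ u.1 = c.
Proof.
have [[a [b [s [ab me]]]]|no] :=
    pselect (exists a b s, a < b /\ m = f a b s); last first.
  (* Nothing is [below m] here, so any two levels serve. *)
  exists m, m => u [a [b [s [ab me _]]]]; case: no; by exists a, b, s.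
have [[c [x h]]|no] := pselect (exists c x, last_split a b s c x); last first.
  exists a, a => u [a' [b' [s' [ab' me' h]]]].
  move: me'; rewrite me => /(f_inj ab ab')[? ? ?]; subst a' b' s'.
  case: h => [[-> _]|[y _ [x _ h]]]; first by left.
  by case: no; exists u.1, x.
exists a, c => u [a' [b' [s' [ab' me' h']]]].
move: me'; rewrite me => /(f_inj ab ab')[? ? ?]; subst a' b' s'.
case: h' => [[-> _]|[y _ [x' _ h']]]; first by left.
by right; have [] := last_split_fun h' h.
Qed.

(** * Finiteness and common upper bounds in [P] *)

Lemma below_finite m : finite_set (below m).
Proof.
have [[a [b [s [ab me]]]]|no] :=
    pselect (exists a b s, a < b /\ m = f a b s); last first.
  apply: sub_finite_set (finite_set0 _) => u [a [b [s [ab me _]]]].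
  by case: no; exists a, b, s.
pose A := [set ((a, z) : P i f) | z in [set z | z <= LSeq s]].
have finA : finite_set A by apply: finite_image; exact: L_le_finite.
have ABu u : below m u -> A u \/ exists y x, [/\ u.2 = LNat y, y <= x &
    last_split a b s u.1 x].
  case=> a' [b' [s' [ab' me' h]]].
  move: me'; rewrite me => /(f_inj ab ab')[? ? ?]; subst a' b' s'.
  case: h => [[ua [t ut ts]]|[y uy [x yx h]]]; last by right; exists y, x.
  by left; exists (LSeq t) => //; rewrite -ua -ut; case: (u).
have [[c [x h]]|no] := pselect (exists c x, last_split a b s c x); last first.
  apply: sub_finite_set finA => u /ABu[//|[y [x [_ _ h]]]].
  by case: no; exists u.1, x.
apply: (@sub_finite_set _ _
  (A `|` [set ((c, z) : P i f) | z in [set z | z <= LNat x]])).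
  move=> u /ABu[?|[y [x' [uy yx h']]]]; first by left.
  have [uc xx] := last_split_fun h' h; subst x'.
  by right; exists (LNat y) => //; rewrite -uc -uy; case: (u).
rewrite finite_setU; split=> //.
by apply: finite_image; exact: L_le_finite.
Qed.

Lemma down_finite v : v.2 <> LTop -> finite_set (down_set v).
Proof.
move=> vT; apply: sub_finite_set
  (finite_image (fun z => (v.1, z) : P i f) (L_le_finite vT)).
move=> u /(P_le_notop vT)[uv1 uv2].
by exists u.2 => //; rewrite -uv1; case: (u).
Qed.

(** A non-maximal element has a finite down-set, and a maximal element of another level has only
    finitely many elements of level [m] under it. *)
Lemma infinite_level_le (S : set (P i f)) m v :
  infinite_set S -> (forall u, S u -> u.1 = m) ->
  (forall u, S u -> u <= v) -> v = top m.
Proof.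
move=> infS Sm Sv.
have vT : v.2 = LTop.
  apply: contra_notP infS => vT; exact: sub_finite_set (down_finite vT).
case: v vT Sv => q z /= -> Sv; congr (_, _).
apply: contra_notP infS => /nesym mq; apply: sub_finite_set (below_finite q).
by move=> u Su; have /le_topP[|//] := Sv u Su; rewrite (Sm u Su).
Qed.

(** If [u] is not below [top v.1], then [m = f p b s] with lower level [p = u.1] and upper level
    [v.1], and [u] carries all of [s]. Moreover [b] is read off [v.1], which is [b] itself or some
    [f p b s0], so [m] is determined. *)
Lemma common_top_uniq m n u v : u.1 < v.1 ->
  u <= top m -> v <= top m -> u <= top n -> v <= top n ->
  m = n \/ u <= top v.1.
Proof.
case: u v => p z [q w] /= pq /le_topP um /le_topP vm /le_topP un /le_topP vn.
have [uq|uNq] := pselect (((p, z) : P i f) <= top q); [by right|left].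
have key k : p = k \/ below k (p, z) -> q = k \/ below k (q, w) ->
    exists b s, [/\ p < b, k = f p b s, z = LSeq s &
      exists x, last_split p b s q x].
  move=> uk [qk|vk].
    by case: uNq; apply/le_topP; rewrite qk.
  case: uk => [pk|uk].
    by have := below_lt vk; rewrite -pk /= => /(lt_trans pq); rewrite ltxx.
  case: uk => a [b [s [ab ke hu]]]; case: vk => a' [b' [s' [ab' ke' hv]]].
  move: ke'; rewrite ke => /(f_inj ab ab')[? ? ?]; subst a' b' s'.
  case: hv => [[/= qa _]|[/= y _ [x _ h]]].
    subst q; case: hu => [[/= pa _]|[_ _ [x _ /(last_split_lt ab)[/= ap _]]]].
      by move: pq; rewrite pa ltxx.
    by have := lt_trans ap pq; rewrite ltxx.
  case: hu => [[/= pa [t zt ts]]|[_ _ [x' _ h']]]; last first.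
    by have [/= e _] := last_split_fun h h'; move: pq; rewrite e ltxx.
  subst a; exists b, s; split=> //; last by exists x.
  (* A proper prefix [t] of [s = s0.x] would be a prefix of [s0], placing [u] below [top q] since
     [q = f p b s0]. *)
  rewrite zt; congr LSeq; case: (h) => [[se qb]|[s0 se qe]].
    by move: ts; rewrite se => /neseq_le1.
  move: (ts); rewrite se => /neseq_le_catP[ts0|//].
  case: uNq; apply/le_topP; right; exists p, b, s0; split=> //.
  by left; split=> //; exists t.
have [b [s [pb -> zs [x h]]]] := key m um vm.
have [b' [s' [pb' -> zs' [x' h']]]] := key n un vn.
move: zs'; rewrite zs => -[e]; subst s'.
case: h => [[se qb]|[s0 se qb]]; case: h' => [[se' qb']|[s1 se' qb']].
- by rewrite -qb -qb'.
- by move: se'; rewrite se => /neseq1_neq_cat.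
- by move: se; rewrite se' => /neseq1_neq_cat.
by move: qb'; rewrite qb => /(f_inj pb pb')[_ -> _].
Qed.

(** * Directed families of bounded sets *)

Definition bounded_family (D : set (set (P i f))) : Prop :=
  exists m, forall A, D A -> A `<=` down_set (top m).

(** If some [u], [v] in the union have [u.1 < v.1] and [u] not below [top v.1], a member containing
    both fixes the bound of every larger member by [common_top_uniq]. Otherwise an unbounded family
    climbs through ever higher levels, against [below_levels]. *)
Lemma directed_family_bounded (D : set (set (P i f))) :
  D !=set0 ->
  (forall A B, D A -> D B -> exists C, [/\ D C, A `<=` C & B `<=` C]) ->
  (forall A, D A -> exists m, A `<=` down_set (top m)) ->
  bounded_family D.
Proof.
move=> [A0 DA0] dD bD.
pose W := [set u | exists2 A, D A & A u].
have [[u [v [[A DA Au] [B DB Bv] uv uNv]]]|no] :=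
    pselect (exists u v, [/\ W u, W v, u.1 < v.1 & ~ u <= top v.1]).
  have [C [DC AC BC]] := dD _ _ DA DB; have [m Cm] := bD _ DC.
  exists m => E DE; have [F [DF CF EF]] := dD _ _ DC DE.
  have [n Fn] := bD _ DF.
  have [->|//] : m = n \/ u <= top v.1; last exact: subset_trans EF Fn.
  apply: common_top_uniq => //.
  - exact/Cm/AC.
  - exact/Cm/BC.
  - exact/Fn/CF/AC.
  - exact/Fn/CF/BC.
apply: contrapT => unb.
have next m : exists2 v, W v & ~ v <= top m.
  apply: contra_notP unb => noW; exists m => A DA u Au.
  by apply: contra_notP noW => um; exists u => //; exists A.
have le_W u v : W u -> W v -> u.1 < v.1 -> u <= top v.1.
  by move=> Wu Wv uv; apply: contra_notP no => uNv; exists u, v.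
have succ u : W u -> exists2 v, W v & u.1 < v.1.
  move=> Wu; have [v Wv vNu] := next u.1; exists v => //.
  have [//|] := ltP u.1 v.1; rewrite le_eqVlt => /orP[/eqP vu|vu].
    by case: vNu; apply/le_topP; left.
  by case: vNu; exact: le_W.
(* Four levels suffice: the three under [u3.1] exceed the two that [below_levels] allows. *)
have [m _] := bD _ DA0; have [u0 W0 _] := next m.
have [u1 W1 u01] := succ _ W0; have [u2 W2 u12] := succ _ W1.
have [u3 W3 u23] := succ _ W2.
have [a [c ac]] := below_levels u3.1.
have lev u : W u -> u.1 < u3.1 -> u.1 = a \/ u.1 = c.
  move=> Wu u3u; apply: ac; have /le_topP[e|//] := le_W _ _ Wu W3 u3u.
  by move: u3u; rewrite e ltxx.
have u13 := lt_trans u12 u23; have u03 := lt_trans u01 u13.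
have u02 := lt_trans u01 u12.
by have := lev _ W0 u03; have := lev _ W1 u13; have := lev _ W2 u23;
  move=> [] e2 [] e1 [] e0; move: u01 u02 u12; rewrite e0 e1 e2 ltxx.
Qed.

(** * The sets in [M]; countability and completeness of [R] *)

Lemma M_leE (A B : M i f) : (A <= B) <-> (val A `<=` val B).
Proof. by rewrite leEsub subsetEset. Qed.

Lemma M_gen (A : M i f) :
  exists2 E : set (P i f), E !=set0 & val A = \bigcap_(x in E) down_set x.
Proof. exact: set_mem (valP A). Qed.

Definition bigcap_down (E : set (P i f)) (E0 : E !=set0) : M i f :=
  exist (fun A => A \in _) (\bigcap_(x in E) down_set x)
    (mem_set (ex_intro2 _ _ E E0 erefl)).

Definition down_M v : M i f :=
  bigcap_down (ex_intro [set v] v erefl).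

Lemma val_down_M v : val (down_M v) = down_set v.
Proof. exact: bigcap_set1. Qed.

Lemma le_down_M (A : M i f) v : (A <= down_M v) <-> (val A `<=` down_set v).
Proof. by rewrite M_leE val_down_M. Qed.

Lemma down_M_mono u v : u <= v -> down_M u <= down_M v.
Proof.
move=> uv; apply/M_leE; rewrite !val_down_M => w /= wu; exact: le_trans wu uv.
Qed.

Lemma le_top_ex v : exists m, v <= top m.
Proof. by case: v => n x; exists n; exact: P_le_level (le_LTop x). Qed.

Lemma M_le_top (A : M i f) : exists m, A <= down_M (top m).
Proof.
have [E [v Ev] AE] := M_gen A; have [m vm] := le_top_ex v; exists m.
apply/le_down_M; rewrite AE => w /(_ v Ev) /= wv; exact: le_trans wv vm.
Qed.

(** Of two distinct generators, either one is non-maximal and has a finite down-set, or they are the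
    tops of two levels; no element lies on both levels, so each is [below] one of the tops. *)
Lemma M_finite_or_down (A : M i f) :
  finite_set (val A) \/ exists v, val A = down_set v.
Proof.
have [E [v Ev] AE] := M_gen A.
have [vE|] := pselect (forall w, E w -> w = v).
  right; exists v; rewrite AE; apply/seteqP; split=> [w|w wv x /vE-> //].
  exact.
move/existsNP => [w /not_implyP[Ew wv]]; left.
have Av : val A `<=` down_set v by rewrite AE => x; apply.
have Aw : val A `<=` down_set w by rewrite AE => x; apply.
have [vT|vNT] := pselect (v.2 = LTop); last first.
  exact: sub_finite_set Av (down_finite vNT).
have [wT|wNT] := pselect (w.2 = LTop); last first.
  exact: sub_finite_set Aw (down_finite wNT).
case: v vT Ev wv Av {AE} => m z /= -> Ev wv Av.
case: w wT Ew wv Aw => n z' /= -> Ew wv Aw.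
apply: (@sub_finite_set _ _ (below m `|` below n)); last first.
  by rewrite finite_setU; split; exact: below_finite.
move=> u Au; have /le_topP[um|] := Av u Au; last by left.
have /le_topP[un|] := Aw u Au; last by right.
by case: wv; rewrite -un um.
Qed.

Lemma R_countable : countable [set: R i f].
Proof.
pose F (c : seq (P i f) + P i f) : set (P i f) :=
  match c with inl s => [set` s] | inr v => down_set v end.
have /choice[g gF] : forall A : M i f, exists c, F c = val A.
  move=> A; have [/finite_seqP[s ->]|[v ->]] := M_finite_or_down A.
    by exists (inl s).
  by exists (inr v).
apply/countable_injP; exists (fun r : R i f => pickle (omap g r)).
move=> r r' _ _ /(pcan_inj pickleK).
case: r r' => [A|] [B|] //= -[e]; congr Some; apply/val_inj.
by rewrite -!gF e.
Qed.

Lemma R_complete : complete_lattice (R i f).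
Proof.
have infE (S : set (R i f)) : infimums S !=set0.
  (* A member of [M] is the intersection of the principal down-sets containing it, so intersecting
     all those that contain some member of [S] gives the infimum. *)
  pose E := [set v | exists2 A : M i f, S (Some A) & val A `<=` down_set v].
  have [E0|noE] := pselect (E !=set0).
    exists (Some (bigcap_down E0)); split.
      case=> [A SA|//]; apply/M_leE => u Eu; have [F F0 AF] := M_gen A.
      rewrite AF => v Fv; apply: Eu; exists A => //.
      by rewrite AF => w; apply.
    case=> [B lB|lN].
      apply/M_leE => u Bu v [A SA Av]; apply: Av.
      by have /M_leE := lB _ SA; apply.
    by have [v [A SA _]] := E0; have := lN _ SA.
  (* Every set in [M] is bounded, so [E] is empty only if [S] contains no element of [M]. *)
  exists None; split; last by case.
  case=> [A SA|//]; case: noE; have [m Am] := M_le_top A.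
  by exists (top m); exists A => //; exact/le_down_M.
move=> S; split=> //; have [x [lx gx]] := infE (ubound S).
exists x; split=> //.
by move=> y Sy; apply: gx => z; apply.
Qed.

(** * Scott-open subsets of [R] *)

Notation T m := (Some (down_M (top m)) : R i f).

Lemma infinite_level_le_M (S : set (P i f)) m (A : M i f) :
  infinite_set S -> (forall u, S u -> u.1 = m) -> S `<=` val A ->
  down_M (top m) <= A.
Proof.
move=> infS Sm SA; apply/M_leE; rewrite val_down_M.
have [E _ AE] := M_gen A; rewrite AE => u um v Ev.
rewrite (@infinite_level_le S m v infS Sm) // => w /SA; rewrite AE; exact.
Qed.

(** An upper bound of the chain in [M] contains an infinite part of level [m], hence the whole
    down-set of [top m]; so the supremum is [T m]. *)
Lemma scott_open_chain (U : set (R i f)) m (x : nat -> P i f) :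
  scott_open U -> (forall k, (x k).1 = m) -> injective x ->
  (forall k l, (k <= l)%N -> x k <= x l) ->
  U (T m) -> exists k, U (Some (down_M (x k))).
Proof.
move=> [_ oU] xm x_inj x_mono UT.
pose D := range (fun k => Some (down_M (x k)) : R i f).
have dD : directed_set D.
  split; first by exists (Some (down_M (x 0%N))); exists 0%N.
  move=> _ _ [k _ <-] [l _ <-]; exists (Some (down_M (x (maxn k l)))).
  split; first by exists (maxn k l).
    by apply: down_M_mono; apply: x_mono; rewrite leq_maxl.
  by apply: down_M_mono; apply: x_mono; rewrite leq_maxr.
have sD : supremums D (T m).
  split=> [_ [k _ <-]|[A uA|//]].
    by apply: down_M_mono; apply/le_topP; left.
  apply: (@infinite_level_le_M (range x)) => [|_ [k _ <-] //|_ [k _ <-]].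
    move=> fin; apply: infinite_nat.
    apply: sub_finite_set (finite_preimage (in2W x_inj) fin).
    by move=> k _; exists k.
  have /M_leE := uA _ (ex_intro2 _ _ k Logic.I erefl); apply.
  by rewrite val_down_M; exact: lexx.
by have [r [Ur [k _ kr]]] := oU D _ dD sD UT; exists k; rewrite kr.
Qed.

(** This covers both the first step, with [c = b] and one-letter sequences, and the later ones, with
    [c = f a b s] and the extensions of [s] by a letter. The chain used is [(c, LNat k)]. *)
Lemma scott_open_last_split (V : set (R i f)) a b c (g : posnat -> neseq) :
  scott_open V -> a < b -> (forall x, last_split a b (g x) c x) ->
  V (T c) -> exists x, V (T (f a b (g x))).
Proof.
move=> oV ab gx Vc; pose y (k : nat) : posnat := exist _ k.+1 isT.
have [k Vk] : exists k, V (Some (down_M (c, LNat (y k)))).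
  apply: (scott_open_chain oV _ _ _ Vc) => [//|k l [] //|k l kl].
  exact: P_le_level.
exists (y k); apply: (proj1 oV _ _ Vk); apply: down_M_mono.
apply/le_topP; right; exists a, b, (g (y k)); split=> //; right.
by exists (y k) => //; exists (y k).
Qed.

Lemma scott_open_meet_lt (U V : set (R i f)) m n :
  scott_open U -> scott_open V -> m < n -> U (T m) -> V (T n) ->
  exists p, U (T p) /\ V (T p).
Proof.
move=> oU oV mn Um Vn.
have [x Vx] : exists x, V (T (f m n (neseq1 x))).
  by apply: (scott_open_last_split oV mn _ Vn) => x; left.
(* Stating the membership as a premise makes [g] total; its value is arbitrary where the premise
   fails. *)
have /choice[g Vg] : forall s, exists x, V (T (f m n s)) ->
    V (T (f m n (neseq_cat s (neseq1 x)))).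
  move=> s; have [Vs|?] := pselect (V (T (f m n s))); last by exists x.
  have [y Vy] : exists y, V (T (f m n (neseq_cat s (neseq1 y)))).
    by apply: (scott_open_last_split oV mn _ Vs) => y; right; exists s.
  by exists y.
pose t k := iter k (fun s => neseq_cat s (neseq1 (g s))) (neseq1 x).
have Vt k : V (T (f m n (t k))) by elim: k => [//|k IH]; exact: Vg.
have t_size k : size (val (t k)) = k.+1.
  by elim: k => [//|k IH]; rewrite /= size_cat addn1; congr _.+1.
have t_le k l : (k <= l)%N -> neseq_le (t k) (t l).
  elim: l => [|l IH]; first by rewrite leqn0 => /eqP->; exact: prefix_refl.
  rewrite leq_eqVlt => /predU1P[->|/IH kl]; first exact: prefix_refl.
  apply: prefix_trans kl _; exact: prefix_prefix.
have [k Uk] : exists k, U (Some (down_M (m, LSeq (t k)))).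
  apply: (scott_open_chain oU _ _ _ Um) => [//|k l [] //|k l kl].
    by move/(congr1 (size \o val)); rewrite /= !t_size => -[].
  by apply: P_le_level; exact: t_le.
exists (f m n (t k)); split=> //; apply: (proj1 oU _ _ Uk).
apply: down_M_mono; apply/le_topP; right; exists m, n, (t k); split=> //.
by left; split=> //; exists (t k) => //; exact: prefix_refl.
Qed.

Lemma scott_open_meet (U V : set (R i f)) (A B : M i f) :
  scott_open U -> scott_open V -> U (Some A) -> V (Some B) ->
  exists p, U (T p) /\ V (T p).
Proof.
move=> oU oV UA VB; have [m Am] := M_le_top A; have [n Bn] := M_le_top B.
have Um : U (T m) by exact: (proj1 oU _ _ UA).
have Vn : V (T n) by exact: (proj1 oV _ _ VB).
have [mn|nm|mn] := ltgtP m n.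
- exact: scott_open_meet_lt oU oV mn Um Vn.
- by have [p [? ?]] := scott_open_meet_lt oV oU nm Vn Um; exists p.
by exists m; split=> //; rewrite mn.
Qed.

Lemma scott_open_None : scott_open [set None : R i f].
Proof.
split=> [x [y|//] -> //|D s [D0 dD] [uD lD] sN].
rewrite sN in uD lD.
apply: contrapT => noD.
have DN : ~ D None by move=> DN; apply: noD; exists None.
pose D' := [set A | exists2 B : M i f, D (Some B) & A = val B].
have [] : bounded_family D'.
  apply: directed_family_bounded.
  - by case: D0 => -[B DB|/DN//]; exists (val B); exists B.
  - move=> _ _ [A DA ->] [B DB ->].
    have [[C|] [DC AC BC]] := dD _ _ DA DB; last by case: (DN DC).
    by exists (val C); split; [exists C|exact/M_leE|exact/M_leE].
  - move=> _ [A DA ->]; have [m /le_down_M Am] := M_le_top A.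
    by exists m.
(* [None <= T m] is false by computation, yet [T m] bounds [D], whose supremum is [None]. *)
move=> m Dm; suff : (None : R i f) <= T m by [].
apply: lD => -[A DA|/DN//]; apply/le_down_M; apply: Dm.
by exists A.
Qed.

(** * Failure of sobriety *)

Lemma closed_le (d : Order.disp_t) (Q : porderType d) (x : Q) :
  closed ([set y | y <= x] : set (scott Q)).
Proof.
rewrite -openC; apply/scott_openE; split=> [y z /= yx yz zx|D s _ sD /= sx].
  exact/yx/(le_trans yz zx).
apply: contrapT => noD; apply: sx; apply: (proj2 sD) => y Dy.
by apply: contrapT => yx; apply: noD; exists y.
Qed.

Lemma R_not_sober : ~ sober_space (scott (R i f)).
Proof.
case=> _ /(_ [set~ None]) []; first 2 last.
- case=> [A|] e; last first.
    suff : [set~ None] (None : scott (R i f)) by apply.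
    by rewrite e; exact: subset_closure.
  have [m Am] := M_le_top A.
  (* The closure of [Some A] stays under [T m], so it misses [T n] for any other level [n]. *)
  have [n nm] : exists n : posnat, n <> m.
    have [mm|] := pselect (m = exist _ 1%N isT :> posnat).
      by exists (exist _ 2%N isT); rewrite mm.
    by exists (exist _ 1%N isT); apply/nesym.
  have : closure [set (Some A : scott (R i f))] (T n) by rewrite -e.
  rewrite closureE => /(_ [set y | y <= (Some A : R i f)]) nA.
  have /M_leE : down_M (top n) <= down_M (top m).
    apply: le_trans Am; apply: nA; split; first exact: closed_le.
    by move=> _ -> /=.
  rewrite !val_down_M => /(_ (top n) (lexx _)) /le_topP[//|].
  by case=> a [b [s [_ _ [[_ [? //]]|[? //]]]]].
- rewrite -openC setCK; apply/scott_openE; exact: scott_open_None.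
split; first by exists (T (exist _ 1%N isT)).
move=> B C cB cC BC; apply: contrapT => /not_orP[].
have notin (D : set (R i f)) : ~ [set~ None] `<=` D ->
    exists A : M i f, ~ D (Some A).
  by move=> /existsNP[[A|] /not_implyP[]]; [exists A|case].
move=> /notin[A nBA] /notin[A' nCA'].
(* The complements of [B] and [C] are open and both meet [M], so they share some [T p], which [B]
   and [C] fail to cover. *)
have [p [Bp Cp]] := scott_open_meet (proj1 (scott_openE _) (closed_openC cB))
  (proj1 (scott_openE _) (closed_openC cC)) nBA nCA'.
by case: (BC (T p) _).
Qed.

End PosetP.

Theorem mainTheorem4
    (i : posnat -> posnat -> set posnat)
    (f : posnat -> posnat -> neseq -> posnat)
    (i_infinite : forall m n : posnat, m < n -> infinite_set (i m n))
    (i_gt : forall m n : posnat, m < n -> forall k, i m n k -> n < k)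
    (i_disj : forall m1 n1 m2 n2 : posnat, m1 < n1 -> m2 < n2 ->
      (m1, n1) <> (m2, n2) -> i m1 n1 `&` i m2 n2 = set0)
    (f_bij : forall m n : posnat, m < n -> set_bij [set: neseq] (i m n) (f m n))
    (f_mono : forall m n : posnat, m < n ->
      forall s t : neseq, neseq_le s t -> f m n s <= f m n t) :
  [/\ countable [set: R i f],
      complete_lattice (R i f) &
      ~ sober_space (scott (R i f))].
Proof.
split; first exact: R_countable i_disj f_bij.
  exact: R_complete.
exact: R_not_sober i_gt i_disj f_bij f_mono.
Qed.
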